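(* Let $(E,\mathcal{E})$ be a Polish space with its Borel $\sigma$-algebra, let $n$ be a finite positive integer, and let $X^+=(X^+_0,\ldots,X^+_n)$ and $X^-=(X^-_0,\ldots,X^-_n)$ be two discrete-time $E$-valued random processes begun at the same fixed initial point and run up to time $n$. Then a MEXIT coupling of $X^+$ and $X^-$ (up to time $n$) exists.
   Context: For $0\le k\le n$ let $\mu_k^{\pm}$ be the law of $(X_0^\pm,\ldots,X_k^\pm)$ on $E^{k+1}$, and let $\hat\mu_k=\mu_k^+\wedge\mu_k^-$ be the meet measure, i.e. the largest non-negative measure $\tilde\mu$ on $E^{k+1}$ with $\tilde\mu(D)\le\min\{\mu_k^+(D),\mu_k^-(D)\}$ for all measurable $D$. A coupling of $X^+$ and $X^-$ is a pair of processes defined on a common probability space whose individual laws are those of $X^+$ and $X^-$ (still denoted $X^+,X^-$). It is a MEXIT (maximal exit) coupling up to time $n$ if, simultaneously for every $k=0,1,\ldots,n$ and every measurable $D\subseteq E^{k+1}$, $$\mathbb{P}\left[(X_0^+,\ldots,X_k^+)\in D,\ X_i^+=X_i^-\text{ for all }0\le i\le k\right]=\hat\mu_k(D),$$ so that for every $k$ the probability of agreement throughout times $0,\ldots,k$ is the maximum possible over all couplings. *)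

(* Defs.v *)
From HB Require Import structures.
From mathcomp Require Import all_boot all_order all_algebra.
From mathcomp Require Import all_classical all_reals all_analysis.

Set Implicit Arguments.
Unset Strict Implicit.
Unset Printing Implicit Defensive.

Import Order.TTheory GRing.Theory Num.Theory.

Local Open Scope classical_set_scope.
Local Open Scope ring_scope.

Record complete_metric (R : realType) (E : topologicalType) (dist : E -> E -> R)
    : Prop := CompleteMetric {
  dist_xx : forall x, dist x x = 0 ;
  dist_eq0 : forall x y, dist x y = 0 -> x = y ;
  dist_sym : forall x y, dist x y = dist y x ;
  dist_triangle : forall x y z, dist x z <= dist x y + dist y z ;
  dist_nbhs : forall (x : E) (A : set E),
    nbhs x A <-> exists2 r : R, 0 < r & [set y | dist x y < r] `<=` A ;
  dist_complete : forall u : nat -> E,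
    (forall e : R, 0 < e -> exists N : nat, forall i j : nat,
       (N <= i)%N -> (N <= j)%N -> dist (u i) (u j) < e) ->
    exists l : E, u i @[i --> \oo] --> l }.

Definition polish_space (R : realType) (E : topologicalType) : Prop :=
  (exists2 S : set E, countable S & dense S) /\
  (exists dist : E -> E -> R, complete_metric dist).

Notation borel E := (g_sigma_algebraType (@open E)).

Section process.
Context {R : realType} {E : ptopologicalType} {n : nat}.
Context {d : measure_display} {T : measurableType d} {P : probability T R}.

(* [k : 'I_n.+1], so [ltn_ord k : k < n.+1] is also a proof of [k.+1 <= n.+1]. *)
Definition initial_segment (X : 'I_n.+1 -> {RV P >-> borel E}) (k : 'I_n.+1)
    (w : T) : k.+1.-tuple (borel E) :=
  [tuple X (widen_ord (ltn_ord k) i) w | i < k.+1].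

Lemma measurable_initial_segment (X : 'I_n.+1 -> {RV P >-> borel E})
    (k : 'I_n.+1) : measurable_fun [set: T] (initial_segment X k).
Proof.
apply/measurable_fun_tnthP => i.
rewrite (_ : _ \o _ = X (widen_ord (ltn_ord k) i)).
  exact: measurable_funPT.
by apply/funext => w /=; rewrite tnth_mktuple.
Qed.

HB.instance Definition _ (X : 'I_n.+1 -> {RV P >-> borel E}) (k : 'I_n.+1) :=
  isMeasurableFun.Build _ _ _ _ (initial_segment X k)
    (@measurable_initial_segment X k).

Definition law (X : 'I_n.+1 -> {RV P >-> borel E}) (k : 'I_n.+1) :
    probability (k.+1.-tuple (borel E)) R :=
  distribution P (initial_segment X k).

(* The almost sure form depends only on the law of [X], hence is inherited by
   couplings. *)
Definition begun_at (X : 'I_n.+1 -> {RV P >-> borel E}) (x0 : E) : Prop :=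
  {ae P, forall w, X ord0 w = x0}.

Definition agreement (Xp Xm : 'I_n.+1 -> {RV P >-> borel E}) (k : 'I_n.+1) :
    set T :=
  [set w | forall i : 'I_n.+1, (i <= k)%N -> Xp i w = Xm i w].

End process.

Section meet.
Context {R : realType} {d : measure_display} {T : measurableType d}.

Definition below_both (mu nu m : {measure set T -> \bar R}) : Prop :=
  forall D : set T, measurable D -> (m D <= Order.min (mu D) (nu D))%E.

Definition is_meet (mu nu m : {measure set T -> \bar R}) : Prop :=
  below_both mu nu m /\
  forall m' : {measure set T -> \bar R}, below_both mu nu m' ->
    forall D : set T, measurable D -> (m' D <= m D)%E.

End meet.

(* [X] and [Y] may live on different probability spaces. *)
Definition same_law (R : realType) (E : ptopologicalType) (n : nat)
    (d : measure_display) (T : measurableType d) (P : probability T R)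
    (X : 'I_n.+1 -> {RV P >-> borel E})
    (d' : measure_display) (T' : measurableType d') (P' : probability T' R)
    (Y : 'I_n.+1 -> {RV P' >-> borel E}) : Prop :=
  forall D : set ((ord_max : 'I_n.+1).+1.-tuple (borel E)), measurable D ->
    law X ord_max D = law Y ord_max D.

(* Since the [m] below is unique on measurable sets, the existential only says
   that the left-hand side is the meet measure. *)
Definition mexit (R : realType) (E : ptopologicalType) (n : nat)
    (d : measure_display) (T : measurableType d) (P : probability T R)
    (Xp Xm : 'I_n.+1 -> {RV P >-> borel E}) : Prop :=
  forall k : 'I_n.+1,
    exists2 m : {measure set (k.+1.-tuple (borel E)) -> \bar R},
      is_meet (law Xp k) (law Xm k) m &
      forall D : set (k.+1.-tuple (borel E)), measurable D ->
        P (initial_segment Xp k @^-1` D `&` agreement Xp Xm k) = m D.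

(* Main.v *)
Require Import Defs.
From HB Require Import structures.
From mathcomp Require Import all_boot all_order all_algebra.
From mathcomp Require Import all_classical all_reals all_analysis.
From mathcomp Require Import measurable_realfun lra.

(**
Let mu and nu be the two path laws on E^(n+1), let m_k be the meet of their
projections to times 0..k, and call a finite measure p on pairs of paths a
subcoupling when its marginals are at most mu and nu. The coupling is built
backwards in time, as an increasing family of subcouplings.

Suppose that p is concentrated on pairs of paths that agree up to time k+1 and
that the common past under p has law m_(k+1). Seen at time k, that past has a
law of at most m_k, because the restriction of m_(k+1) is below both projected
laws. The deficit e of p with respect to m_k is at most the projection of the
unused part mu - p_1 of mu, since m_k is at most the projection of mu; so one
can choose a measure a <= mu - p_1 on whole paths whose projection is exactly e
(multiply by a density that depends on the past only, [extend_marginal]), and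
likewise b <= nu - p_2. Joining a and b along their common past
([glue_marginals]) and adding the result to p gives a subcoupling that agrees
up to time k and whose common past has law m_k ([fill_agreement]). Adding mass
cannot spoil the lower bounds already achieved at later times. At time 0 both
processes sit at the same point, so m_0 has full mass, and a subcoupling of
full mass has marginals equal to mu and nu. No coupling can do better than the
meet, so the lower bounds are equalities ([nested_agreement_coupling]).
That two paths glued along their past up to time k separate at time k+1 is a
consequence of this optimality.

Gluing two measures along a common projection is where E has to be Polish. The
second path must be redrawn from its conditional law given the past of the
first. Rather than building conditional laws as kernels, a path is coded by
countably many bits, and the bits are redrawn from one uniform variable u: the
unit interval is cut into nested intervals, indexed by finite bit strings,
whose lengths are the conditional probabilities of these strings given the
past, and u selects one branch ([random_bits_law]). A measurable decoding map
turns the bits back into a path. For a Polish space the bits record in which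
small balls around a dense sequence a point lies, and decoding takes a limit,
which exists by completeness ([bitstream_retract_borel]).
*)

Set Implicit Arguments.
Unset Strict Implicit.
Unset Printing Implicit Defensive.

Import Order.TTheory GRing.Theory Num.Theory.

Local Open Scope classical_set_scope.
Local Open Scope ring_scope.

(** * Finite measures, bounded densities and subtraction *)

Lemma fin_addeI (R : numDomainType) (x y z : \bar R) : x \is a fin_num ->
  (x + y = x + z)%E -> y = z.
Proof. by case: x y z => [x| |] [y| |] [z| |] //= _ [/addrI ->]. Qed.

Section finite_measures.
Local Open Scope ereal_scope.
Context {R : realType} {d : measure_display} {T : measurableType d}.
Implicit Types a b c : {finite_measure set T -> \bar R}.

Lemma finite_restr (m : {measure set T -> \bar R}) (D : set T) :
  measurable D -> m D < +oo -> exists a, forall A, a A = m (A `&` D).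
Proof. by move=> mD moo; exists (mfrestr mD moo). Qed.

Lemma finite_measure_of (m : {measure set T -> \bar R}) : m setT < +oo ->
  exists a, forall A, a A = m A.
Proof.
by case/(finite_restr measurableT) => a aE; exists a => A; rewrite aE setIT.
Qed.

Lemma finite_measureD a b : exists c, forall A, c A = a A + b A.
Proof.
have [|c cE] := @finite_measure_of (measure_add a b).
  rewrite [ltLHS](measure_addE a b) lte_add_pinfty// fin_num_fun_lty//;
    exact: fin_num_measure.
by exists c => A; rewrite cE; exact: (measure_addE a b).
Qed.

Lemma finite_pushforward a d' (S : measurableType d') (f : T -> S) :
  measurable_fun setT f ->
  exists c' : {finite_measure set S -> \bar R}, forall A, c' A = a (f @^-1` A).
Proof.
move=> mf; pose m : {measure set S -> \bar R} := pushforward a f.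
have moo : m mf setT < +oo.
  by rewrite /m /= /pushforward preimage_setT fin_num_fun_lty//; exact: fin_num_measure.
exists (mfrestr measurableT moo) => A.
by rewrite -[in RHS](setIT A).
Qed.

Lemma finite_density a (h : T -> \bar R) : measurable_fun setT h ->
  (forall x, 0 <= h x) -> (forall x, h x <= 1) ->
  exists c, forall A, c A = \int[a]_(x in A) h x.
Proof.
move=> mh h0 h1.
have inth : a.-integrable [set: T] h.
  apply/integrableP; split => //.
  apply: (@le_lt_trans _ _ (\int[a]_x (cst 1 x))).
    apply: ge0_le_integral => //; first exact: measurableT_comp.
    by move=> x _; rewrite gee0_abs// h1.
  by rewrite integral_cst// mul1e fin_num_fun_lty//; exact: fin_num_measure.
have h0' A : 0 <= induced_charge inth A by exact: integral_ge0.
have [|c cE] := @finite_measure_of (measure_of_charge _ h0').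
  by rewrite -ge0_fin_numE//; exact: (fin_num_measure (induced_charge inth)).
by exists c => A; rewrite cE.
Qed.

(** A form of the Radon-Nikodym theorem in which the bounds 0 <= h' <= h hold
    at every point, not only almost everywhere, so that h' and h - h' can be used
    as conditional weights with no exceptional set. Truncating the derivative f
    to min(f, h) keeps the integrals: where f exceeds h, the integral of h already
    dominates b. *)
Lemma density_le a b (h : T -> \bar R) : measurable_fun setT h ->
  (forall x, 0 <= h x) -> (forall x, h x <= 1) ->
  (forall A, measurable A -> b A <= \int[a]_(x in A) h x) ->
  exists h' : T -> \bar R, [/\ measurable_fun setT h', (forall x, 0 <= h' x <= h x) &
    forall A, measurable A -> b A = \int[a]_(x in A) h' x].
Proof.
move=> mh h0 h1 bh.
have ba : b `<< a.
  apply/null_content_dominatesP => A mA aA0.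
  apply/eqP; rewrite -measure_le0 (le_trans (bh _ mA))//.
  by rewrite null_set_integral//; exact: measurable_funTS.
have [f [f0 intf fE]] := radon_nikodym_finite ba.
have mf : measurable_fun setT f by exact: measurable_int intf.
exists (fun x => mine (f x) (h x)); split.
- exact: measurable_mine.
- by move=> x; rewrite le_min f0 h0/= ge_min lexx orbT.
move=> A mA.
have mm : measurable_fun setT (fun x => mine (f x) (h x)) by exact: measurable_mine.
apply/eqP; rewrite eq_le; apply/andP; split; last first.
  rewrite fE//; apply: ge0_le_integral => //; [|exact: measurable_funTS..|].
    by move=> x _; rewrite le_min f0 h0.
  by move=> x _; rewrite ge_min lexx.
pose N := [set x | h x < f x].
have mN : measurable N by rewrite -[N]setTI; exact: emeasurable_fun_lt.
have splitA (g : T -> \bar R) : measurable_fun setT g -> (forall x, 0 <= g x) ->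
    \int[a]_(x in A) g x = \int[a]_(x in A `&` N) g x + \int[a]_(x in A `&` ~` N) g x.
  move=> mg g0; rewrite -ge0_integral_setU//.
  - by rewrite -setIUr setUv setIT.
  - exact: measurableI.
  - by apply: measurableI => //; exact: measurableC.
  - exact: measurable_funTS.
  - by apply/disj_setPS => x [[_ ?] [_ ?]].
rewrite splitA//; last by move=> x; rewrite le_min f0 h0.
have -> : \int[a]_(x in A `&` N) mine (f x) (h x) = \int[a]_(x in A `&` N) h x.
  by apply: eq_integral => x; rewrite inE => -[_ xN]; rewrite min_r// ltW.
have -> : \int[a]_(x in A `&` ~` N) mine (f x) (h x) = \int[a]_(x in A `&` ~` N) f x.
  apply: eq_integral => x; rewrite inE => -[_ /negP xN]; rewrite min_l//.
  by rewrite leNgt.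
have mAN : measurable (A `&` N) by exact: measurableI.
have mANC : measurable (A `&` ~` N) by apply: measurableI => //; exact: measurableC.
rewrite -fE// -[in leLHS](setIT A) -(setUv N) setIUr measureU//.
  by rewrite leeD2r// bh.
by rewrite setIACA setICr setI0.
Qed.

Lemma finite_measureB a b : (forall A, measurable A -> b A <= a A) ->
  exists c, forall A, measurable A -> b A + c A = a A.
Proof.
move=> ba.
have b1 A : measurable A -> b A <= \int[a]_(x in A) cst 1 x.
  by move=> mA; rewrite integral_cst// mul1e ba.
have [h [mh h01 hE]] := density_le (measurable_cst _) (fun=> lee01) (fun=> lexx _) b1.
have h0 x : 0 <= h x by case/andP : (h01 x).
have h1 x : h x <= 1 by case/andP : (h01 x).
have mh' : measurable_fun setT (fun x => 1 - h x) by exact: emeasurable_funB.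
have hfin x : h x \is a fin_num by rewrite ge0_fin_numE// (le_lt_trans (h1 x)) ?ltry.
have h'0 x : 0 <= 1 - h x by rewrite sube_ge0 ?h1 ?hfin.
have h'1 x : 1 - h x <= 1 by rewrite leeBlDr// leeDl.
have [c cE] := finite_density a mh' h'0 h'1.
exists c => A mA; rewrite cE hE// -ge0_integralD//; [|exact: measurable_funTS..].
rewrite (eq_integral (cst 1)) ?integral_cst ?mul1e// => x _ /=.
by rewrite addeC subeK.
Qed.

End finite_measures.

Section marginals.
Local Open Scope ereal_scope.
Context {R : realType} {d : measure_display} {T : measurableType d}.
Implicit Types a b c : {finite_measure set T -> \bar R}.

(** A bound between projections lifts to the whole space: reweighting a by the
    density of e with respect to the projection of a, read through Z, keeps the
    conditional law of a given Z and stays below a because that density is at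
    most 1. *)
Lemma finite_product a d' (S : measurableType d')
    (b : {finite_measure set S -> \bar R}) :
  exists c' : {finite_measure set (T * S)%type -> \bar R}, forall A, c' A = (a \x b) A.
Proof.
have [|c' c'E] := @finite_measure_of _ _ _ (a \x b).
  rewrite -setXTT [ltLHS]product_measure1E//.
  by rewrite lte_mul_pinfty// ?fin_num_measure// ltey_eq fin_num_measure.
by exists c'.
Qed.

Lemma extend_marginal a d' (S : measurableType d') (Z : T -> S)
    (e : {finite_measure set S -> \bar R}) : measurable_fun setT Z ->
  (forall A, measurable A -> e A <= a (Z @^-1` A)) ->
  exists b, (forall A, measurable A -> b A <= a A) /\
    (forall A, measurable A -> b (Z @^-1` A) = e A).
Proof.
move=> mZ eZ.
have [e0 e0E] := finite_pushforward a mZ.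
have b1 A : measurable A -> e A <= \int[e0]_(x in A) cst 1 x.
  move=> mA; rewrite integral_cst// mul1e.
  by rewrite (le_trans (eZ _ mA))// -(e0E A).
have [h [mh h01 hE]] := density_le (measurable_cst _) (fun=> lee01) (fun=> lexx _) b1.
have h0 x : 0 <= h x by case/andP : (h01 x).
have h1 x : h x <= 1 by case/andP : (h01 x).
have mhZ : measurable_fun setT (h \o Z) by exact: measurableT_comp.
have [b bE] := finite_density a mhZ (fun x => h0 (Z x)) (fun x => h1 (Z x)).
exists b; split=> A mA.
  rewrite bE; apply: (@le_trans _ _ (\int[a]_(x in A) cst 1 x)).
    by apply: ge0_le_integral => //; [move=> x _; exact: h0|exact: measurable_funTS|
      move=> x _; exact: h1].
  by rewrite integral_cst// mul1e.
rewrite hE// bE.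
rewrite -(ge0_integral_pushforward mZ)//; last exact: measurable_funTS.
by apply: eq_measure_integral => B mB _; exact/esym/e0E.
Qed.

End marginals.

(** * Existence of the meet *)

Section meet_existence.
Local Open Scope ereal_scope.
Context {R : realType} {d : measure_display} {T : measurableType d}.
Implicit Types a b c : {finite_measure set T -> \bar R}.

(** On the negative part N of a Hahn decomposition of a - b the smaller of the two
    measures is a, on the positive part it is b. *)
Lemma exists_meet a b : exists c, is_meet a b c.
Proof.
have [P [N [[mP posP] [mN negN] PNT PN0]]] := Hahn_decomposition
  (cadd (charge_of_finite_measure a) (copp (charge_of_finite_measure b))).
have ab A : measurable A -> A `<=` N -> a A <= b A.
  move=> mA AN; have := negN _ mA AN; rewrite /cadd /copp /= /charge_of_finite_measure.
  by rewrite sube_le0.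
have ba A : measurable A -> A `<=` P -> b A <= a A.
  move=> mA AP; have := posP _ mA AP; rewrite /cadd /copp /= /charge_of_finite_measure.
  by rewrite sube_ge0// fin_num_measure.
have split_mu (m : {measure set T -> \bar R}) A : measurable A ->
    m A = m (A `&` N) + m (A `&` P).
  move=> mA; rewrite -measureU//.
  - by rewrite -setIUr (setUC N) PNT setIT.
  - exact: measurableI.
  - exact: measurableI.
  - by rewrite setIACA (setIC N) PN0 setI0.
have aN : a N < +oo by rewrite ltey_eq fin_num_measure.
have bP : b P < +oo by rewrite ltey_eq fin_num_measure.
have [c1 c1E] := finite_restr mN aN.
have [c2 c2E] := finite_restr mP bP.
have [c cE] := finite_measureD c1 c2.
have mE A : (c : {measure set T -> \bar R}) A = a (A `&` N) + b (A `&` P).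
  by rewrite -c1E -c2E; exact: cE.
exists c; split=> [A mA|m' m'ab A mA].
  rewrite le_min; apply/andP; split.
    rewrite mE (split_mu a A)// leeD2l// ba//; exact: measurableI.
  rewrite mE (split_mu b A)// leeD2r// ab//; exact: measurableI.
have mAN : measurable (A `&` N) by exact: measurableI.
have mAP : measurable (A `&` P) by exact: measurableI.
rewrite (split_mu m' A)// mE leeD//.
  by have := m'ab _ mAN; rewrite le_min => /andP[].
by have := m'ab _ mAP; rewrite le_min => /andP[].
Qed.

End meet_existence.

(** * The space of bit sequences *)

(** The first j bits, the latest first: extending the sequence by one bit is then a
    cons, and recursion on a bit string goes back in time. *)
Fixpoint initial_bits (b : nat -> bool) (j : nat) : seq bool :=
  if j is k.+1 then b k :: initial_bits b k else [::].

Definition cylinder (s : seq bool) : set (nat -> bool) :=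
  [set b | initial_bits b (size s) = s].

(** The empty set makes the family closed under intersection: two cylinders are
    nested or disjoint. *)
Definition cylinders : set (set (nat -> bool)) :=
  [set C | C = set0 \/ exists s, C = cylinder s].

Notation bitstream := (g_sigma_algebraType cylinders).

Lemma size_initial_bits b j : size (initial_bits b j) = j.
Proof. by elim: j => //= j ->. Qed.

Lemma cylinder_nil : cylinder [::] = setT.
Proof. by apply/seteqP; split. Qed.

Lemma cylinder_cons x s :
  cylinder (x :: s) = cylinder s `&` [set b | b (size s) = x].
Proof.
by apply/seteqP; split=> b; rewrite /cylinder /=; [case=> <- ->|case=> -> ->].
Qed.

Lemma initial_bits_drop b i j : (i <= j)%N ->
  initial_bits b i = drop (j - i) (initial_bits b j).
Proof.
elim: j => [|j IH]; first by rewrite leqn0 => /eqP ->.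
rewrite leq_eqVlt => /orP[/eqP ->|ij]; first by rewrite subnn drop0.
by rewrite IH// subSn.
Qed.

Lemma cylinders_setI : setI_closed cylinders.
Proof.
have H s t : (size s <= size t)%N -> cylinders (cylinder s `&` cylinder t).
  move=> st; have [e|ne] := eqVneq (drop (size t - size s) t) s.
    right; exists t; apply/seteqP; split=> b; first by case.
    move=> bt; split => //; rewrite /cylinder /=.
    by rewrite (initial_bits_drop _ st) [initial_bits b (size t)]bt.
  left; rewrite -subset0 => b [bs bt]; move/eqP: ne; apply.
  by have := initial_bits_drop b st; rewrite [initial_bits _ _]bs [initial_bits _ _]bt => <-.
move=> _ _ [->|[s ->]] [->|[t ->]]; rewrite ?(set0I, setI0); try by left.
by have [/H//|/ltnW/H] := leqP (size s) (size t); rewrite setIC.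
Qed.

Lemma measurable_cylinder s : measurable (cylinder s : set bitstream).
Proof. by apply: sub_sigma_algebra; right; exists s. Qed.

Lemma measurable_bit i : measurable [set b : bitstream | (b : nat -> bool) i].
Proof.
rewrite (_ : [set b | _] =
    \bigcup_s (if size s == i then cylinder (true :: s) else set0)).
  apply: countable_bigcupT_measurable => // s; case: ifP => // _.
  exact: measurable_cylinder.
apply/seteqP; split=> b /=.
  move=> bi; exists (initial_bits b i) => //.
  by rewrite size_initial_bits eqxx /cylinder /= size_initial_bits bi.
by case=> s _; case: eqP => // <-; rewrite cylinder_cons => -[].
Qed.

Lemma measurable_fun_cylinders d (T : measurableType d) (f : T -> bitstream) :
  (forall s, measurable (f @^-1` cylinder s)) -> measurable_fun setT f.
Proof.
move=> mf; apply: (measurability (cylinders : set (set bitstream))) => // _ [_ [->|[s ->]] <-].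
  by rewrite preimage_set0 setI0.
by rewrite setTI.
Qed.

Lemma measurable_fun_bits d (T : measurableType d) (f : T -> bitstream) :
  (forall i, measurable [set x | f x i]) -> measurable_fun setT f.
Proof.
move=> mf; apply: measurable_fun_cylinders; elim => [|x s IH].
  by rewrite cylinder_nil preimage_setT.
rewrite cylinder_cons preimage_setI; apply: measurableI => //.
case: x; first exact: mf.
rewrite (_ : _ @^-1` _ = ~` [set x | f x (size s)]); first exact: measurableC.
by apply/seteqP; split=> b /=; case: (f b (size s)).
Qed.

(** The uniqueness theorem for measures on intersection-closed generators is used
    twice, for B with A fixed and then for the rectangles A x B. *)
Lemma finite_measure_cylinder_unique (R : realType) d (S : measurableType d)
    (m1 m2 : {finite_measure set (S * bitstream)%type -> \bar R}) :
  (forall A s, measurable A -> m1 (A `*` cylinder s) = m2 (A `*` cylinder s)) ->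
  forall G, measurable G -> m1 G = m2 G.
Proof.
move=> m12.
have step A : measurable A -> forall B : set bitstream, measurable B ->
    m1 (A `*` B) = m2 (A `*` B).
  move=> mA.
  have mAT : measurable (A `*` setT : set (S * bitstream)%type) by exact: measurableX.
  have tr (m : {finite_measure set (S * bitstream)%type -> \bar R}) :
      exists m' : {finite_measure set bitstream -> \bar R}, forall B, m' B = m (A `*` B).
    have mAoo : (m (A `*` setT) < +oo)%E by rewrite ltey_eq fin_num_measure.
    have [n nE] := finite_restr mAT mAoo.
    have [m' m'E] := finite_pushforward n (@measurable_snd _ _ S bitstream).
    exists m' => B; rewrite m'E nE; congr (m _).
    by apply/seteqP; split=> -[x b] /=; [case=> ? []|case].
  have [m1' m1'E] := tr m1; have [m2' m2'E] := tr m2.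
  move=> B mB; rewrite -m1'E -m2'E.
  apply: (measure_unique (cylinders : set (set bitstream)) (fun=> setT)) => //.
  - exact: cylinders_setI.
  - by move=> _; right; exists [::]; rewrite cylinder_nil.
  - by rewrite bigcup_const.
  - move=> _ [->|[s ->]]; first by rewrite !measure0.
    by rewrite [LHS]m1'E [RHS]m2'E m12.
  - by move=> _; rewrite fin_num_fun_lty//; exact: fin_num_measure.
move=> G mG.
apply: (measure_unique [set A `*` B | A in measurable & B in measurable] (fun=> setT)) => //.
- exact: measurable_prod_measurableType.
- move=> _ _ [A mA [B mB <-]] [A' mA' [B' mB' <-]]; rewrite -setXI.
  by exists (A `&` A'); [exact: measurableI|exists (B `&` B') => //; exact: measurableI].
- by move=> _; exists setT => //; exists setT => //; rewrite setXTT.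
- by rewrite bigcup_const.
- by move=> _ [A mA [B mB <-]]; exact: step.
- by move=> _; rewrite fin_num_fun_lty//; exact: fin_num_measure.
Qed.

(** * Redrawing a bit sequence given the past *)

Section unit_interval.
Context {R : realType}.

Lemma lebesgue_unit_lty : (lebesgue_measure `[0%R, 1%R[%classic < +oo :> \bar R)%E.
Proof. by rewrite lebesgue_measure_itv /= lte_fin ltr01 sube0 ltry. Qed.

(** Lebesgue measure restricted to [0, 1[, the law of the uniform variable that
    drives the randomization. *)
Lemma unit_lebesgue : exists l : {finite_measure set (measurableTypeR R) -> \bar R},
  [/\ l setT = 1%E, l (~` `[0, 1[%classic) = 0%E &
  forall a b : R, 0 <= a -> a <= b -> b <= 1 -> l `[a, b[%classic = (b - a)%:E].
Proof.
have [l lE] := finite_restr (m := lebesgue_measure : {measure set (measurableTypeR R) -> \bar R})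
  (measurable_itv `[0%R, 1%R[) lebesgue_unit_lty.
have leb (a b : R) : a <= b -> lebesgue_measure (`[a, b[%classic : set R) = (b - a)%:E.
  move=> ab; rewrite lebesgue_measure_itv /= lte_fin; case: ltgtP ab => // -> _.
  by rewrite subrr.
exists l; split.
- by rewrite lE setTI; have := leb _ _ ler01; rewrite subr0.
- by rewrite lE setICl measure0.
move=> a b a0 ab b1; rewrite lE setIidl; first exact: leb.
move=> x /=; rewrite !in_itv /= => /andP[ax xb].
by rewrite (le_trans a0)//= (lt_le_trans xb).
Qed.

End unit_interval.

Section randomization.
Context {R : realType} {d : measure_display} {S : measurableType d}.
Variable nu : {finite_measure set (S * bitstream)%type -> \bar R}.
Local Notation T01 := (measurableTypeR R).

(** h z is a conditional probability, given z, that the bit sequence begins with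
    the bits of s. *)
Definition is_density (e : {finite_measure set S -> \bar R}) s (h : S -> R) :=
  [/\ measurable_fun setT h, (forall z, 0 <= h z <= 1) &
    forall A, measurable A ->
      nu (A `*` cylinder s) = (\int[e]_(z in A) (h z)%:E)%E].

(** The weight of s is shared exactly, at every z, between the two strings that
    extend s by one bit: only the density of the string with bit true is chosen,
    and the other one is the complement. *)
Lemma split_density (e : {finite_measure set S -> \bar R}) s h :
  is_density e s h -> exists h' : S -> R, [/\ is_density e (true :: s) h',
    is_density e (false :: s) (fun z => h z - h' z) & forall z, h' z <= h z].
Proof.
move=> [mh h01 hE].
have h0 z : 0 <= h z by case/andP: (h01 z).
have h1 z : h z <= 1 by case/andP: (h01 z).
have mC t : measurable (setT `*` cylinder t : set (S * bitstream)%type).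
  by apply: measurableX => //; exact: measurable_cylinder.
have nuoo : (nu (setT `*` cylinder (true :: s)) < +oo)%E.
  by rewrite ltey_eq fin_num_measure.
have [g gE] := finite_restr (mC (true :: s)) nuoo.
have [g' g'E] := finite_pushforward g (@measurable_fst _ _ S bitstream).
have {g gE} g'E A : g' A = nu (A `*` cylinder (true :: s)).
  rewrite g'E gE; congr (nu _).
  by apply/seteqP; split=> -[x b] /=; [case=> ? []|case].
have mEh : measurable_fun setT (EFin \o h) by exact/measurable_EFinP.
have cylT : cylinder (true :: s) `<=` cylinder s by rewrite cylinder_cons => b [].
have mAs A t : measurable A -> measurable (A `*` cylinder t : set (S * bitstream)%type).
  by move=> mA; apply: measurableX => //; exact: measurable_cylinder.
have g'h A : measurable A -> (g' A <= \int[e]_(z in A) (EFin \o h) z)%E.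
  move=> mA; rewrite -hE// (g'E A) le_measure ?inE//; try exact: mAs.
  by apply: setSX.
have [k [mk k01 kE]] := density_le mEh (fun z => h0 z) (fun z => h1 z) g'h.
have kfin z : k z \is a fin_num.
  have /andP[k0 kh] := k01 z.
  by rewrite ge0_fin_numE// (le_lt_trans kh)//= ltry.
have kE' z : (fine (k z))%:E = k z by rewrite fineK.
have k0 z : 0 <= fine (k z) by case/andP: (k01 z); rewrite -kE' lee_fin.
have kh z : fine (k z) <= h z by case/andP: (k01 z) => _; rewrite -[leLHS]kE' lee_fin.
have mfk : measurable_fun setT (fine \o k) by exact/measurableT_comp.
exists (fine \o k); split.
- split=> //; first by move=> z; rewrite k0 (le_trans (kh z)).
  move=> A mA; rewrite -g'E kE//.
  by apply: eq_integral => z _; rewrite -kE'.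
- split.
  + exact: measurable_funB.
  + by move=> z; rewrite subr_ge0 kh lerBlDr (le_trans (h1 z))// lerDl k0.
  move=> A mA.
  have tE : (nu (A `*` cylinder (true :: s)) = \int[e]_(z in A) (fine (k z))%:E)%E.
    rewrite -g'E kE//.
    by apply: eq_integral => z _; rewrite -kE'.
  have : (nu (A `*` cylinder s) =
      nu (A `*` cylinder (true :: s)) + nu (A `*` cylinder (false :: s)))%E.
    rewrite -measureU//; try exact: mAs.
      congr (nu _); rewrite !cylinder_cons; apply/seteqP; split=> -[x b] /=.
        by case=> Ax bs; case bE: (b (size s)); [left|right].
      by case=> -[? []].
    rewrite !cylinder_cons -subset0 => -[x b] /= [[_ [_ b1]] [_ [_]]].
    by rewrite b1.
  rewrite hE//.
  rewrite (eq_integral (fun z => (fine (k z))%:E + (h z - fine (k z))%:E)%E); last first.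
    by move=> z _; rewrite -EFinD subrKC.
  rewrite ge0_integralD//.
  + move=> sum; have tfin : nu (A `*` cylinder (true :: s)) \is a fin_num.
      by rewrite fin_num_measure//; exact: mAs.
    by rewrite -tE in sum; exact/esym/(fin_addeI tfin).
  + by move=> z _; rewrite lee_fin.
  + by apply: measurable_funTS; exact/measurable_EFinP.
  + by move=> z _; rewrite lee_fin subr_ge0.
  + by apply: measurable_funTS; apply/measurable_EFinP; exact: measurable_funB.
by move=> z; exact: kh.
Qed.

End randomization.

Section bit_randomization.
Context {R : realType} {d : measure_display} {S : measurableType d}.
Variable nu : {finite_measure set (S * bitstream)%type -> \bar R}.
Variable e : {finite_measure set S -> \bar R}.
Hypothesis eE : forall A, measurable A -> e A = nu (A `*` setT).
Variable true_part : seq bool * (S -> R) -> (S -> R).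
Hypothesis true_partP : forall p, is_density nu e p.1 p.2 ->
  [/\ is_density nu e (true :: p.1) (true_part p),
      is_density nu e (false :: p.1) (fun z => p.2 z - true_part p z) &
      forall z, true_part p z <= p.2 z].

(** The string s is given at z the interval of length [weight s z] starting at
    [left_end s z]; the intervals of the two extensions of s, true on the left,
    partition the interval of s. *)
Fixpoint weight (s : seq bool) : S -> R :=
  match s with
  | [::] => cst 1
  | true :: t => true_part (t, weight t)
  | false :: t => fun z => weight t z - true_part (t, weight t) z
  end.

Fixpoint left_end (s : seq bool) (z : S) : R :=
  match s with
  | [::] => 0
  | true :: t => left_end t z
  | false :: t => left_end t z + weight (true :: t) z
  end.

(** The string of length j whose interval contains u. *)
Fixpoint branch (z : S) (u : R) (j : nat) : seq bool :=
  if j is k.+1 then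
    let s := branch z u k in (u < left_end s z + weight (true :: s) z) :: s
  else [::].

Definition random_bits (zu : S * measurableTypeR R) : bitstream :=
  fun k => head false (branch zu.1 zu.2 k.+1).

Lemma weight_density s : is_density nu e s (weight s).
Proof.
elim: s => [|x s IH]; last by have [? ? _] := true_partP (p := (s, weight s)) IH; case: x.
split=> [|z|A mA]; first exact: measurable_cst.
  by rewrite ler01 lexx.
by have := integral_cst e mA 1%E; rewrite /cst mul1e cylinder_nil -eE// => <-.
Qed.

Lemma weight_ge0 s z : 0 <= weight s z.
Proof. by have [_ /(_ z) /andP[]] := weight_density s. Qed.

Lemma weight_split s z : weight (true :: s) z + weight (false :: s) z = weight s z.
Proof. by rewrite /= subrKC. Qed.

Lemma left_end_cons x s z : left_end (x :: s) z =
  if x then left_end s z else left_end s z + weight (true :: s) z.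
Proof. by case: x. Qed.

Lemma measurable_weight s : measurable_fun setT (weight s).
Proof. by have [] := weight_density s. Qed.

Lemma measurable_left_end s : measurable_fun setT (left_end s).
Proof.
elim: s => [|[] s IH] //=.
by apply: measurable_funD => //; exact: (measurable_weight (true :: s)).
Qed.

Lemma interval_in_unit s z : 0 <= left_end s z /\ left_end s z + weight s z <= 1.
Proof.
elim: s => [|x s [l0 l1]]; first by rewrite /= add0r.
have := weight_split s z; have := weight_ge0 (true :: s) z.
have := weight_ge0 (false :: s) z.
rewrite left_end_cons; case: x; move: (weight (true :: s) z) (weight (false :: s) z) => a b;
  by split; lra.
Qed.

Lemma branchP s z (u : R) : 0 <= u < 1 ->
  (branch z u (size s) == s) = (left_end s z <= u < left_end s z + weight s z).
Proof.
move=> u01; elim: s => [|x s IH]; first by rewrite /= add0r u01.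
have := weight_split s z; have := weight_ge0 (true :: s) z.
have := weight_ge0 (false :: s) z.
have -> : (branch z u (size (x :: s)) == x :: s) =
    (branch z u (size s) == s) && ((u < left_end s z + weight (true :: s) z) == x).
  rewrite [branch _ _ _]/= eqseq_cons andbC.
  by case: eqP => //= ->.
rewrite {}IH.
rewrite left_end_cons; case: x; move: (left_end s z) (weight s z) (weight (true :: s) z)
  (weight (false :: s) z) => l w a b b0 a0 abw; rewrite ?eqb_id ?eqbF_neg -?leNgt.
  by apply/idP/idP; lra.
by apply/idP/idP; lra.
Qed.

Lemma initial_random_bits zu j : initial_bits (random_bits zu) j = branch zu.1 zu.2 j.
Proof. by elim: j => //= j ->. Qed.

Lemma measurable_branch s :
  measurable [set zu : S * measurableTypeR R | branch zu.1 zu.2 (size s) = s].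
Proof.
elim: s => [|x s IH].
  by rewrite (_ : [set _ | _] = setT)//; apply/seteqP.
rewrite (_ : [set _ | _] = [set zu : S * measurableTypeR R | branch zu.1 zu.2 (size s) = s] `&`
   (fun zu => zu.2 < left_end s zu.1 + weight (true :: s) zu.1) @^-1` [set x]); last first.
  by apply/seteqP; split=> -[z u] /=; [case=> <- ->|case=> -> ->].
apply: measurableI => //; rewrite -[X in measurable X]setTI.
apply: (measurable_fun_ltr _ _ measurableT) => //.
apply: measurable_funD.
  exact: (measurableT_comp (measurable_left_end s)).
exact: (measurableT_comp (measurable_weight (true :: s))).
Qed.

Lemma measurable_random_bits : measurable_fun setT random_bits.
Proof.
apply: measurable_fun_cylinders => s.
rewrite (_ : _ @^-1` _ = [set zu | branch zu.1 zu.2 (size s) = s]).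
  exact: measurable_branch.
by apply/seteqP; split=> zu; rewrite /cylinder /= initial_random_bits.
Qed.

Variable l : {finite_measure set (measurableTypeR R) -> \bar R}.
Hypothesis lC : l (~` `[0, 1[%classic) = 0%E.
Hypothesis lE : forall a b : R, 0 <= a -> a <= b -> b <= 1 ->
  l `[a, b[%classic = (b - a)%:E.

(** Inside [0, 1[ the points that select s form exactly the interval of s; outside,
    [branch] still takes values but l puts no mass there. *)
Lemma branch_length s z :
  l [set u | branch z u (size s) = s] = (weight s z)%:E.
Proof.
have [l0 l1] := interval_in_unit s z; have w0 := weight_ge0 s z.
set B := [set u | _].
have mB : measurable (B : set (measurableTypeR R)).
  have -> : B = xsection [set zu : S * measurableTypeR R | branch zu.1 zu.2 (size s) = s] z.
    by apply/seteqP; split=> u; rewrite /xsection /= inE.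
  by apply: measurable_xsection; exact: measurable_branch.
have mI : measurable (`[0, 1[%classic : set (measurableTypeR R)) by exact: measurable_itv.
rewrite -[B](setIT B) -(setUv `[0, 1[%classic) setIUr measureU//; last 3 first.
- exact: measurableI.
- by apply: measurableI => //; exact: measurableC.
- by rewrite setIACA setICr setI0.
rewrite [X in (_ + X)%E](_ : _ = 0%E) ?adde0; last first.
  by apply: (subset_measure0 _ _ _ lC) => //; [apply: measurableI => //|];
    exact: measurableC.
rewrite (_ : _ `&` _ = `[left_end s z, left_end s z + weight s z[%classic).
  have lw : left_end s z <= left_end s z + weight s z by rewrite lerDl.
  by have := lE l0 lw l1; rewrite addrAC subrr add0r.
apply/seteqP; split=> u /=; rewrite !in_itv /=.
  by case=> /eqP bu u01; rewrite -branchP.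
move=> lu; have u01 : 0 <= u < 1 by lra.
by split=> //; apply/eqP; rewrite branchP.
Qed.

(** Both sides give A x cylinder s the mass obtained by integrating the
    length of the interval of s over A, and such sets determine the measure. *)
Lemma random_bits_law (G : set (S * bitstream)) : measurable G ->
  (e \x l)%E [set zu | G (zu.1, random_bits zu)] = nu G.
Proof.
have mf : measurable_fun setT (fun zu : S * measurableTypeR R => (zu.1, random_bits zu)).
  by apply: measurable_fun_pair => //; exact: measurable_random_bits.
have [el elE] := finite_product e l.
have [m mE] := finite_pushforward el mf.
move=> mG; rewrite -elE.
transitivity (m G); first by rewrite mE.
apply: finite_measure_cylinder_unique mG => A s mA.
have [mw w01 wE] := weight_density s.
rewrite mE elE wE// /product_measure1 [RHS]integral_mkcond.
apply: eq_integral => z _ /=; rewrite patchE; case: ifPn => zA.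
  rewrite -branch_length; congr (l _); apply/seteqP; split=> u;
    rewrite /xsection /= inE /= /cylinder /= initial_random_bits //=.
    by case.
  by split=> //; exact: set_mem.
rewrite (_ : xsection _ _ = set0) ?measure0//.
by rewrite -subset0 => u; rewrite /xsection /= inE /= => -[/mem_set]; rewrite (negbTE zA).
Qed.

End bit_randomization.

(** * Gluing two measures along a common projection *)

(** The left inverse g is defined on all bit sequences, which lets redrawn bits be
    decoded even when they are the code of no point. *)
Definition bitstream_retract d (T : measurableType d) : Prop :=
  exists (B : nat -> set T) (g : bitstream -> T),
    [/\ forall i, measurable (B i), measurable_fun setT g &
        forall x, g (fun i => `[<B i x>]) = x].

Section gluing.
Context {R : realType} {d d' : measure_display}.
Context {T : measurableType d} {S : measurableType d'}.
Hypothesis rT : bitstream_retract T.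
Variable Z : T -> S.
Hypothesis mZ : measurable_fun setT Z.

(** A kernel of conditional laws of b given Z, in the form of a function psi of the
    projection and of one uniform variable: it redraws the bits of a point, then
    decodes them. *)
Lemma conditional_randomization (b : {finite_measure set T -> \bar R})
    (e : {finite_measure set S -> \bar R}) :
  (forall A, measurable A -> e A = b (Z @^-1` A)) ->
  exists (l : {finite_measure set (measurableTypeR R) -> \bar R})
    (psi : S * measurableTypeR R -> T),
    [/\ l setT = 1%E, measurable_fun setT psi &
     forall G : set (S * T), measurable G ->
       (e \x l)%E [set zu | G (zu.1, psi zu)] = b [set y | G (Z y, y)]].
Proof.
move=> eZ; have [B [g [mB mg gB]]] := rT.
pose code (x : T) : bitstream := fun i => `[<B i x>].
have mcode : measurable_fun setT code.
  apply: measurable_fun_bits => i.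
  rewrite (_ : [set _ | _] = B i) //.
  by apply/seteqP; split=> x; rewrite /code /= asboolE.
have mZc : measurable_fun setT (fun x => (Z x, code x)) by exact: measurable_fun_pair.
have [nu nuE] := finite_pushforward b mZc.
have eE A : measurable A -> e A = nu (A `*` setT).
  by move=> mA; rewrite nuE eZ//; congr (b _); apply/seteqP; split=> x //= -[].
have /choice[next nextP] : forall p : seq bool * (S -> R), exists h', is_density nu e p.1 p.2 ->
    [/\ is_density nu e (true :: p.1) h',
      is_density nu e (false :: p.1) (fun z => p.2 z - h' z) &
      forall z, h' z <= p.2 z].
  move=> p; have [hp|hp] := pselect (is_density nu e p.1 p.2).
    by have [h' h'P] := split_density hp; exists h'.
  by exists p.2 => /hp.
have [l [l1 lC lE]] := @unit_lebesgue R.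
pose rb := random_bits next.
have mrb : measurable_fun setT rb by refine (measurable_random_bits eE nextP).
exists l, (g \o rb); split=> //; first exact: measurableT_comp.
move=> G mG.
have mgp : measurable_fun setT (fun zb : S * bitstream => (zb.1, g zb.2)).
  by apply: measurable_fun_pair => //; exact: (measurableT_comp mg).
have mG' : measurable [set zb : S * bitstream | G (zb.1, g zb.2)].
  by rewrite -[X in measurable X]setTI; exact: mgp.
transitivity (nu [set zb : S * bitstream | G (zb.1, g zb.2)]).
  exact: (random_bits_law eE nextP lC lE mG').
by rewrite nuE; congr (b _); apply/seteqP; split=> y; rewrite /= gB.
Qed.

Hypothesis mgraph : measurable [set p : S * T | Z p.2 = p.1].

(** Draw x from a and then y from the conditional law under b given Z y = Z x.
    Evaluating the joint law on the graph of Z shows that the redrawn point has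
    the prescribed projection almost surely. *)
Lemma glue_marginals (a b : {finite_measure set T -> \bar R}) :
  (forall A, measurable A -> a (Z @^-1` A) = b (Z @^-1` A)) ->
  exists p : {finite_measure set (T * T)%type -> \bar R},
    [/\ forall A, measurable A -> p (fst @^-1` A) = a A,
        forall A, measurable A -> p (snd @^-1` A) = b A &
        p [set xy | Z xy.1 <> Z xy.2] = 0%E].
Proof.
move=> ab; have [e eE] := finite_pushforward a mZ.
have eb A : measurable A -> e A = b (Z @^-1` A) by move=> mA; rewrite eE ab.
have [l [psi [l1 mpsi psiE]]] := conditional_randomization eb.
have mf : measurable_fun setT (fun xu : T * measurableTypeR R => (xu.1, psi (Z xu.1, xu.2))).
  apply: measurable_fun_pair => //; apply: (measurableT_comp mpsi).
  by apply: measurable_fun_pair => //; exact: measurableT_comp.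
have [al alE] := finite_product a l.
have [p pE] := finite_pushforward al mf.
have push (G : set (S * T)) : measurable G ->
    p [set xy | G (Z xy.1, xy.2)] = b [set y | G (Z y, y)].
  move=> mG; rewrite -psiE// pE alE /product_measure1 /=.
  have mH : measurable [set zu : S * measurableTypeR R | G (zu.1, psi zu)].
    rewrite -[X in measurable X]setTI.
    by apply: (measurable_fun_pair measurable_fst mpsi).
  transitivity (\int[a]_x ((l \o xsection [set zu | G (zu.1, psi zu)]) \o Z) x)%E.
    by apply: eq_integral => x _ /=; congr (l _).
  have ms : measurable_fun setT (l \o xsection [set zu | G (zu.1, psi zu)]).
    exact: measurable_fun_xsection.
  symmetry; transitivity (\int[pushforward a Z]_z (l \o xsection [set zu | G (zu.1, psi zu)]) z)%E.
    by apply: eq_measure_integral => A mA _; exact: eE.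
  by rewrite (ge0_integral_pushforward mZ a measurableT ms).
exists p; split.
- move=> A mA; rewrite pE alE.
  rewrite (_ : _ @^-1` _ = A `*` setT); last by apply/seteqP; split=> -[x u] //= [].
  by have := product_measure1E a l mA measurableT; rewrite [X in (_ * X)%E]l1 mule1.
- move=> A mA; have := push (setT `*` A); rewrite (_ : [set xy | _] = snd @^-1` A); last first.
    by apply/seteqP; split=> -[x y] //= [].
  move=> ->; last exact: measurableX.
  by congr (b _); apply/seteqP; split=> y //= [].
- have := push (~` [set q | Z q.2 = q.1]) (measurableC mgraph).
  have -> : [set y | (~` [set q : S * T | Z q.2 = q.1]) (Z y, y)] = set0.
    by apply/seteqP; split=> y //=; apply.
  rewrite measure0.
  by move=> <-; congr (p _); apply/seteqP; split=> -[x y] /= /nesym.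
Qed.

End gluing.

(** * Filling the agreement up to the meet, backwards in time *)

Section comparison.
Local Open Scope ereal_scope.
Context {R : realType} {d : measure_display} {T : measurableType d}.
Implicit Types a b : {finite_measure set T -> \bar R}.

Lemma eq_measure_off_null a (N A B : set T) : measurable N -> measurable A ->
  measurable B -> a N = 0 -> (forall x, ~ N x -> A x <-> B x) -> a A = a B.
Proof.
move=> mN mA mB aN AB; have mAN := measurableU _ _ mA mN.
have mBN := measurableU _ _ mB mN.
have h (C D : set T) : measurable C -> measurable D -> C `<=` D `|` N -> a C <= a D.
  move=> mC mD CDN; apply: (@le_trans _ _ (a (D `|` N))).
    by rewrite le_measure// inE//; exact: measurableU.
  by rewrite -[leRHS]adde0 -aN measureU2.
apply/eqP; rewrite eq_le !h// => x Cx; have [Nx|Nx] := pselect (N x); try by right.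
  by left; apply/AB.
by left; apply/AB.
Qed.

Lemma eq_measure_le_mass a b : (forall A, measurable A -> a A <= b A) ->
  a setT = b setT -> forall A, measurable A -> a A = b A.
Proof.
move=> ab abT A mA; have mC := measurableC mA.
apply/eqP; rewrite eq_le ab//=.
have fC : b (~` A) \is a fin_num by exact: fin_num_measure.
have sum (c : {finite_measure set T -> \bar R}) : c setT = c A + c (~` A).
  by rewrite -measureU ?setICr ?setUv.
rewrite -(@leeD2rE _ (b (~` A)))// -sum -abT sum leeD2l// ab//.
Qed.

End comparison.

Section filling.
Local Open Scope ereal_scope.
Context {R : realType} {d d' : measure_display}.
Context {T : measurableType d} {S : measurableType d'}.
Hypothesis rT : bitstream_retract T.
Variables mu nu : {finite_measure set T -> \bar R}.

Definition subcoupling (p : {finite_measure set (T * T)%type -> \bar R}) : Prop :=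
  (forall A, measurable A -> p (fst @^-1` A) <= mu A) /\
  (forall A, measurable A -> p (snd @^-1` A) <= nu A).

Variable Z : T -> S.
Hypothesis mZ : measurable_fun setT Z.
Hypothesis mgraph : measurable [set q : S * T | Z q.2 = q.1].

Lemma measurable_agree : measurable [set xy : T * T | Z xy.1 = Z xy.2].
Proof.
have mf : measurable_fun setT (fun xy : T * T => (Z xy.1, xy.2)).
  by apply: measurable_fun_pair => //; exact: measurableT_comp.
rewrite (_ : [set xy | _] = (fun xy : T * T => (Z xy.1, xy.2)) @^-1` [set q | Z q.2 = q.1]).
  by rewrite -[X in measurable X]setTI; exact: mf.
by apply/seteqP; split=> xy /= /esym.
Qed.

Lemma measurable_preimage A : measurable A -> measurable (Z @^-1` A).
Proof. by move=> mA; rewrite -[X in measurable X]setTI; exact: mZ. Qed.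

Lemma measurable_fst_preimage A : measurable A ->
  measurable [set xy : T * T | A (Z xy.1)].
Proof.
by move=> mA; rewrite -[X in measurable X]setTI;
  apply: (measurableT_comp mZ measurable_fst).
Qed.

Lemma measurable_snd_preimage A : measurable A ->
  measurable [set xy : T * T | A (Z xy.2)].
Proof.
by move=> mA; rewrite -[X in measurable X]setTI;
  apply: (measurableT_comp mZ measurable_snd).
Qed.

(** The deficit e = m - q, with q the projection of p, fits below the projections of
    the unused parts r = mu - p_1 and s = nu - p_2, because m lies below those of mu
    and nu. It is therefore lifted to a <= r and to b <= s, which are glued. *)
Lemma fill_agreement (p : {finite_measure set (T * T)%type -> \bar R})
    (m : {finite_measure set S -> \bar R}) :
  subcoupling p -> p [set xy | Z xy.1 <> Z xy.2] = 0 ->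
  (forall A, measurable A -> p [set xy | A (Z xy.1)] <= m A) ->
  (forall A, measurable A -> m A <= mu (Z @^-1` A)) ->
  (forall A, measurable A -> m A <= nu (Z @^-1` A)) ->
  exists p' : {finite_measure set (T * T)%type -> \bar R},
    [/\ subcoupling p', p' [set xy | Z xy.1 <> Z xy.2] = 0,
      forall C, p C <= p' C &
      forall A, measurable A -> p' [set xy | A (Z xy.1)] = m A].
Proof.
move=> [p_mu p_nu] p0 pm m_mu m_nu.
have mZfst : measurable_fun setT (fun xy : T * T => Z xy.1) by exact: measurableT_comp.
have [p1 p1E] := finite_pushforward p (@measurable_fst _ _ T T).
have [p2 p2E] := finite_pushforward p (@measurable_snd _ _ T T).
have [q qE] := finite_pushforward p mZfst.
have p1mu A : measurable A -> p1 A <= mu A by move=> mA; rewrite p1E; exact: p_mu.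
have p2nu A : measurable A -> p2 A <= nu A by move=> mA; rewrite p2E; exact: p_nu.
have qm A : measurable A -> q A <= m A by move=> mA; rewrite qE; exact: pm.
have [r rE] := finite_measureB p1mu.
have [s sE] := finite_measureB p2nu.
have [e eE] := finite_measureB qm.
have p1q A : p1 (Z @^-1` A) = q A by rewrite p1E qE.
have p2q A : measurable A -> p2 (Z @^-1` A) = q A.
  move=> mA; rewrite p2E qE.
  apply: (@eq_measure_off_null _ _ _ p [set xy | Z xy.1 <> Z xy.2]) => //.
  - exact: measurableC measurable_agree.
  - exact: measurable_snd_preimage.
  - exact: measurable_fst_preimage.
  - by move=> xy /contrapT /= ->.
have er A : measurable A -> e A <= r (Z @^-1` A).
  move=> mA; have fq : q A \is a fin_num by exact: fin_num_measure.
  rewrite -(@leeD2lE _ (q A))// eE// -p1q rE ?m_mu//; exact: measurable_preimage.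
have es A : measurable A -> e A <= s (Z @^-1` A).
  move=> mA; have fq : q A \is a fin_num by exact: fin_num_measure.
  by rewrite -(@leeD2lE _ (q A))// eE// -p2q// sE ?m_nu//; exact: measurable_preimage.
have [a [ar aZ]] := extend_marginal mZ er.
have [b [bs bZ]] := extend_marginal mZ es.
have ab A : measurable A -> a (Z @^-1` A) = b (Z @^-1` A).
  by move=> mA; rewrite aZ// bZ.
have [g [g1 g2 g0]] := glue_marginals rT mZ mgraph ab.
have [p' p'E] := finite_measureD p g.
exists p'; split.
- split=> A mA; rewrite p'E.
    by rewrite g1// -(rE A mA) (p1E A) leeD2l// ar.
  by rewrite g2// -(sE A mA) (p2E A) leeD2l// bs.
- by rewrite p'E p0 g0 adde0.
- by move=> C; rewrite p'E leeDl.
- move=> A mA; rewrite p'E -(qE A) -eE//; congr (_ + _).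
  by rewrite -aZ// -g1//; exact: measurable_preimage.
Qed.

End filling.

Section nested_agreement.
Local Open Scope ereal_scope.
Context {R : realType} {d d' : measure_display}.
Context {T : measurableType d} {S : nat -> measurableType d'}.
Hypothesis rT : bitstream_retract T.
Variables mu nu : {finite_measure set T -> \bar R}.
Variable Z : forall k, T -> S k.
Hypothesis mZ : forall k, measurable_fun setT (Z k).
Hypothesis mgraph : forall k, measurable [set q : S k * T | Z k q.2 = q.1].
Variable rho : forall k, S k.+1 -> S k.
Hypothesis mrho : forall k, measurable_fun setT (@rho k).
Hypothesis Zrho : forall k x, Z k x = rho (Z k.+1 x).
Variable m : forall k, {finite_measure set (S k) -> \bar R}.
(* Together, m_mu, m_nu and m_max make m k the meet of the projections of mu and nu
   under Z k. *)
Hypothesis m_mu : forall k A, measurable A -> m k A <= mu (Z k @^-1` A).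
Hypothesis m_nu : forall k A, measurable A -> m k A <= nu (Z k @^-1` A).
Hypothesis m_max : forall k (m' : {finite_measure set (S k) -> \bar R}),
  (forall A, measurable A -> m' A <= mu (Z k @^-1` A)) ->
  (forall A, measurable A -> m' A <= nu (Z k @^-1` A)) ->
  forall A, measurable A -> m' A <= m k A.
Hypothesis mu_nu0 : forall A, measurable A -> mu (Z 0 @^-1` A) = nu (Z 0 @^-1` A).

(** Agreement up to k+1 entails agreement up to k. For the meets this reads: the
    restriction of m (k+1) lies below both projections, hence below m k. *)
Lemma meet_restriction k A : measurable A -> m k.+1 (@rho k @^-1` A) <= m k A.
Proof.
have [m' m'E] := finite_pushforward (m k.+1) (@mrho k).
have ZE B : Z k @^-1` B = Z k.+1 @^-1` (@rho k @^-1` B).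
  by apply/seteqP; split=> x; rewrite /= (Zrho k x).
have mR B : measurable B -> measurable (@rho k @^-1` B).
  by move=> mB; rewrite -[X in measurable X]setTI; exact: mrho.
move=> mA; rewrite -m'E; apply: m_max => // B mB; rewrite m'E ZE.
  by apply: m_mu; exact: mR.
by apply: m_nu; exact: mR.
Qed.

Lemma meet_start : m 0 setT = mu setT.
Proof.
have [m' m'E] := finite_pushforward mu (@mZ 0).
apply/eqP; rewrite eq_le -{1}(preimage_setT (Z 0)) m_mu//=.
rewrite -{1}(preimage_setT (Z 0)) -m'E; apply: m_max => // B mB; rewrite m'E//.
by rewrite mu_nu0.
Qed.

Definition agreement_in k (A : set (S k)) : set (T * T) :=
  [set xy | A (Z k xy.1) /\ Z k xy.1 = Z k xy.2].

Lemma measurable_agreement_in k A : measurable A -> measurable (@agreement_in k A).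
Proof.
move=> mA; exact: (measurableI _ _ (measurable_fst_preimage (@mZ k) mA)
  (measurable_agree (@mZ k) (@mgraph k))).
Qed.

(** Induction on the distance j to the horizon n. Before each filling step the
    masses of agreement at later times are already large enough, and the step
    only increases them. *)
Lemma fill_from_horizon n j k : (k + j = n)%N ->
  exists p : {finite_measure set (T * T)%type -> \bar R},
    [/\ subcoupling mu nu p, p [set xy | Z k xy.1 <> Z k xy.2] = 0,
      forall A, measurable A -> p [set xy | A (Z k xy.1)] = m k A &
      forall i A, (k <= i <= n)%N -> measurable A -> m i A <= p (agreement_in A)].
Proof.
have step k0 (p : {finite_measure set (T * T)%type -> \bar R}) :
    subcoupling mu nu p -> p [set xy | Z k0 xy.1 <> Z k0 xy.2] = 0 ->
    (forall A, measurable A -> p [set xy | A (Z k0 xy.1)] <= m k0 A) ->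
    (forall i A, (k0 < i <= n)%N -> measurable A -> m i A <= p (agreement_in A)) ->
  exists p : {finite_measure set (T * T)%type -> \bar R},
    [/\ subcoupling mu nu p, p [set xy | Z k0 xy.1 <> Z k0 xy.2] = 0,
      forall A, measurable A -> p [set xy | A (Z k0 xy.1)] = m k0 A &
      forall i A, (k0 <= i <= n)%N -> measurable A -> m i A <= p (agreement_in A)].
  move=> sp p0 pm pi.
  have [p' [sp' p'0 pp' p'm]] := fill_agreement rT (@mZ k0) (@mgraph k0) sp p0 pm
    (@m_mu k0) (@m_nu k0).
  exists p'; split=> // i A /andP[]; rewrite leq_eqVlt => /orP[/eqP ki|ki] kn mA.
    subst i; rewrite -p'm//.
    rewrite (@eq_measure_off_null _ _ _ p' [set xy | Z k0 xy.1 <> Z k0 xy.2] _ (agreement_in A))//.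
    - by apply: measurableC; exact: measurable_agree.
    - exact: (measurable_fst_preimage (@mZ k0) mA).
    - exact: measurable_agreement_in.
    - by move=> xy /contrapT /= xy12; split=> [|[]].
  by rewrite (le_trans (pi i A _ mA))// ki.
elim: j k => [|j IH] k.
  rewrite addn0 => ->.
  (* At the horizon the filling step starts from the zero measure. *)
  have [|p pE] := @finite_measure_of R _ (T * T)%type mzero; first by rewrite /mzero ltry.
  apply: (step _ p).
  - by split=> A mA; rewrite pE; exact: measure_ge0.
  - by rewrite pE.
  - by move=> A mA; rewrite pE; exact: measure_ge0.
  - by move=> i A /andP[ni /(leq_trans ni)]; rewrite ltnn.
rewrite addnS -addSn => /IH[p [sp p0 pm pi]].
apply: (step _ p) => //.
- apply: (subset_measure0 _ _ _ p0).
  + by apply: measurableC; exact: measurable_agree.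
  + by apply: measurableC; exact: measurable_agree.
  + by move=> xy /= + Zxy; rewrite (Zrho k xy.1) (Zrho k xy.2) Zxy.
- move=> A mA; have mA' : measurable (@rho k @^-1` A).
    by rewrite -[X in measurable X]setTI; exact: mrho.
  have := pm _ mA'; rewrite (_ : [set xy | _] = [set xy | A (Z k xy.1)]).
    by move=> ->; exact: meet_restriction.
  by apply/seteqP; split=> xy; rewrite /= -Zrho.
Qed.

(** The subcoupling filled down to time 0 has the mass of mu and nu, so its
    marginals are mu and nu. The law of the common past on the event of
    agreement is then itself below both projections, hence below the meet. *)
Theorem nested_agreement_coupling n :
  exists p : {finite_measure set (T * T)%type -> \bar R},
    [/\ forall A, measurable A -> p (fst @^-1` A) = mu A,
        forall A, measurable A -> p (snd @^-1` A) = nu A &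
        forall k A, (k <= n)%N -> measurable A -> p (agreement_in A) = m k A].
Proof.
have [p [[p_mu p_nu] p0 pm pi]] := fill_from_horizon (add0n n).
have [p1 p1E] := finite_pushforward p (@measurable_fst _ _ T T).
have [p2 p2E] := finite_pushforward p (@measurable_snd _ _ T T).
have pT := pm _ measurableT.
have p_fst A : measurable A -> p (fst @^-1` A) = mu A.
  move=> mA; rewrite -(p1E A); apply: eq_measure_le_mass => // [B mB|].
    by rewrite p1E p_mu.
  by rewrite p1E -meet_start -pT.
have p_snd A : measurable A -> p (snd @^-1` A) = nu A.
  move=> mA; rewrite -(p2E A); apply: eq_measure_le_mass => // [B mB|].
    by rewrite p2E p_nu.
  by rewrite p2E -(preimage_setT (Z 0)) -mu_nu0// preimage_setT -meet_start -pT.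
exists p; split=> // k A kn mA; apply/eqP; rewrite eq_le pi// andbT.
have magree := measurable_agree (@mZ k) (@mgraph k).
have agree_oo : p [set xy | Z k xy.1 = Z k xy.2] < +oo by rewrite ltey_eq fin_num_measure.
have [q qE] := finite_restr magree agree_oo.
have mZfst : measurable_fun setT (fun xy : T * T => Z k xy.1) by exact: measurableT_comp.
have [m' m'E] := finite_pushforward q mZfst.
have m'A B : m' B = p (agreement_in B) by rewrite m'E qE.
rewrite -m'A; apply: m_max => // B mB; rewrite m'A.
  rewrite -p_fst; last exact: measurable_preimage.
  rewrite le_measure ?inE//.
  - exact: measurable_agreement_in.
  - exact: (measurable_fst_preimage (@mZ k)).
  - by move=> xy [].
rewrite -p_snd; last exact: measurable_preimage.
rewrite le_measure ?inE//.
- exact: measurable_agreement_in.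
- exact: (measurable_snd_preimage (@mZ k)).
- by move=> xy [] /= + <-.
Qed.

End nested_agreement.

(** * Polish spaces and their finite powers as retracts of the bit sequences *)

Lemma bitstream_retract_tuple d (T : measurableType d) n :
  bitstream_retract T -> bitstream_retract (n.-tuple T).
Proof.
move=> [B [g [mB mg gB]]].
pose B' j : set (n.-tuple T) :=
  if (unpickle j : option ('I_n * nat)) is Some (i, k)
  then [set x | B k (tnth x i)] else set0.
pose sub (i : 'I_n) (b : bitstream) : bitstream := fun k => b (pickle (i, k)).
exists B', (fun b => [tuple g (sub i b) | i < n]); split.
- move=> j; rewrite /B'; case: (unpickle j) => [[i k]|] //.
  by rewrite -[X in measurable X]setTI; apply: (measurable_tnth i).
- apply/measurable_fun_tnthP => i.
  rewrite (_ : _ \o _ = g \o sub i).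
    apply: measurableT_comp => //; apply: measurable_fun_bits => k.
    exact: measurable_bit.
  by apply/funext => b /=; rewrite tnth_mktuple.
- move=> x; apply: eq_from_tnth => i; rewrite tnth_mktuple -[RHS]gB.
  by congr g; apply/funext => k; rewrite /sub /B' pickleK.
Qed.

(** Two points are equal as soon as they have the same bits. *)
Lemma measurable_diagonal d (T : measurableType d) : bitstream_retract T ->
  measurable [set xy : T * T | xy.1 = xy.2].
Proof.
move=> [B [g [mB mg gB]]].
rewrite (_ : [set xy | _] = \bigcap_k ((B k `*` B k) `|` (~` B k `*` ~` B k))).
  apply: bigcapT_measurable => k.
  by apply: measurableU; apply: measurableX => //; exact: measurableC.
apply/seteqP; split=> -[x y] /= => [-> k _|xy].
  by have [?|?] := pselect (B k y); [left|right].
rewrite -[x]gB -[y]gB; congr g; apply/funext => k; apply/asbool_equiv_eq.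
by have [[]|[]] := xy k I.
Qed.

Definition first_index (P : nat -> bool) : nat :=
  if pselect (exists m, P m) is left exP then ex_minn exP else 0%N.

Lemma first_indexP (P : nat -> bool) : (exists m, P m) -> P (first_index P).
Proof.
by move=> exP; rewrite /first_index; case: pselect => // h; case: ex_minnP.
Qed.

Lemma first_indexE P m : first_index P = m <->
  (P m /\ forall k, (k < m)%N -> ~ P k) \/ (m = 0%N /\ forall k, ~ P k).
Proof.
rewrite /first_index; case: pselect => [exP|nexP].
  case: ex_minnP => k Pk kmin; split=> [<-|[[Pm mmin]|[_ noP]]].
  - left; split=> // i ik Pi; have := kmin _ Pi; by rewrite leqNgt ik.
  - apply/eqP; rewrite eqn_leq kmin//= leqNgt; apply/negP => /mmin; exact.
  - by have := noP _ Pk.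
split=> [<-|[[Pm _]|[-> //]]].
  by right; split=> // k Pk; apply: nexP; exists k.
by case: nexP; exists m.
Qed.

Lemma measurable_first_index d (T : measurableType d) (P : T -> nat -> bool) m :
  (forall k, measurable [set x | P x k]) ->
  measurable [set x | first_index (P x) = m].
Proof.
move=> mP.
rewrite (_ : [set x | _] =
  ([set x | P x m] `&` \bigcap_(k in [set k | (k < m)%N]) ~` [set x | P x k])
  `|` (if m == 0%N then \bigcap_k ~` [set x | P x k] else set0)).
  apply: measurableU.
    apply: measurableI => //; apply: bigcap_measurableType => k _.
    exact: measurableC.
  case: ifP => // _; apply: bigcapT_measurable => k; exact: measurableC.
apply/seteqP; split=> x /=.
  move/first_indexE => [[Pm mmin]|[-> noP]]; first by left; split.
  by right=> k _; exact: noP.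
move=> h; apply/first_indexE; case: h => [[Pm mmin]|]; first by left; split.
by case: eqP => // -> noP; right; split=> // k; exact: noP.
Qed.

Lemma small_inverse (R : realType) (e : R) : 0 < e ->
  exists N, forall l, (N <= l)%N -> l.+1%:R^-1 < e.
Proof.
move=> e0; exists (Num.trunc e^-1) => l Nl.
rewrite invf_plt ?posrE ?ltr0n//.
apply: (lt_le_trans (truncnS_gt _)); by rewrite ler_nat.
Qed.

Section polish.
Context {R : realType} {E : ptopologicalType}.
Variable dist : E -> E -> R.
Hypothesis hdist : complete_metric dist.
Variable pt : nat -> E.
Hypothesis pt_dense : dense (range pt).

Let dxx := dist_xx hdist.
Let dsym := dist_sym hdist.
Let dtri := dist_triangle hdist.
Notation inv l := ((l.+1%:R : R)^-1).
Definition dball (x : E) (r : R) : set E := [set y | dist x y < r].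

Lemma inv_gt0 l : 0 < inv l.
Proof. by rewrite invr_gt0 ltr0n. Qed.

Lemma dist_ge0 x y : 0 <= dist x y.
Proof. by have := dtri x y x; rewrite dxx (dsym y x); lra. Qed.

Lemma dball_open x r : open (dball x r).
Proof.
rewrite openE => y /= xy; apply/(dist_nbhs hdist).
exists (r - dist x y); first by rewrite subr_gt0.
by move=> z /= yz; have := dtri x y z; rewrite /dball /=; lra.
Qed.

Lemma near_point x l : exists m, dist x (pt m) < inv l.
Proof.
have [|y [xy [m _ my]]] := @pt_dense (dball x (inv l)) _ (@dball_open x (inv l)).
  by exists x; rewrite /dball /= dxx inv_gt0.
by exists m; rewrite my.
Qed.

Lemma measurable_dball x r : measurable (dball x r : set (borel E)).
Proof. by apply: sub_sigma_algebra; exact: dball_open. Qed.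

(** Separability: the countably many balls with centre in the dense sequence and
    radius 1/(l+1) generate the Borel sets. *)
Lemma open_dball (U : set E) : open U ->
  U = \bigcup_m \bigcup_l (if `[<dball (pt m) (inv l) `<=` U>]
     then dball (pt m) (inv l) else set0).
Proof.
move=> oU; apply/seteqP; split=> x; last first.
  by case=> m _ [l _]; case: asboolP => // + xm; apply.
move=> Ux; have /(dist_nbhs hdist)[r r0 rU] : nbhs x U by exact: open_nbhs_nbhs.
have [N NP] := @small_inverse R (r / 2) ltac:(by rewrite divr_gt0).
have [m xm] := near_point x N.
exists m => //; exists N => //; case: asboolP => [_|].
  by rewrite /dball /= dsym.
case=> y; rewrite /dball /= => my; apply: rU => /=.
have := NP _ (leqnn N); have := dtri x (pt m) y.
by move: (inv N) xm my => i; lra.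
Qed.

(** When b is the code of x, the bit of index [pickle (m, l)] tells whether the
    distance from [pt m] to x is less than 1/(l+1); then [pt (approx b l)] is within
    1/(l+1) of x. *)
Definition approx (b : nat -> bool) (l : nat) : nat :=
  first_index (fun m => b (pickle (m, l))).

(** Satisfied by every code, by the triangle inequality. For the other bit
    sequences the approximations are replaced by a constant one, so that they
    converge in all cases and decoding is a pointwise limit everywhere. *)
Definition coherent (b : nat -> bool) : Prop := forall k l,
  dist (pt (approx b k)) (pt (approx b l)) < inv k + inv l.

Definition approx_point (b : nat -> bool) (l : nat) : E :=
  if `[<coherent b>] then pt (approx b l) else pt 0.

Lemma approx_point_cvg b : exists x : E, approx_point b i @[i --> \oo] --> x.
Proof.
apply: (dist_complete hdist) => e e0.
have [N NP] := @small_inverse R (e / 2) ltac:(by rewrite divr_gt0).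
exists N => i j /NP Ni /NP Nj; rewrite /approx_point.
by case: asboolP => [/(_ i j)|_]; [move: (inv i) (inv j) Ni Nj => a c; lra|rewrite dxx].
Qed.

Lemma measurable_approx l m : measurable [set b : bitstream | approx b l = m].
Proof. by apply: measurable_first_index => k; exact: measurable_bit. Qed.

Lemma measurable_approx_fun (V : Type) (P : V -> Prop) (f : nat -> V) l :
  measurable [set b : bitstream | P (f (approx b l))].
Proof.
rewrite (_ : [set b | _] = \bigcup_m (if `[<P (f m)>]
    then [set b : bitstream | approx b l = m] else set0)).
  by apply: bigcupT_measurable => m; case: ifP => // _; exact: measurable_approx.
apply/seteqP; split=> b /=.
  by move=> Pb; exists (approx b l) => //; rewrite asboolT.
by case=> m _; case: asboolP => // Pm ->.
Qed.

Lemma measurable_coherent : measurable [set b : bitstream | coherent b].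
Proof.
rewrite (_ : [set b | _] = \bigcap_k \bigcap_l
  [set b : bitstream | dist (pt (approx b k)) (pt (approx b l)) < inv k + inv l]).
  apply: bigcapT_measurable => k; apply: bigcapT_measurable => l.
  rewrite (_ : [set b | _] = \bigcup_m ([set b : bitstream | approx b k = m] `&`
      [set b : bitstream | dist (pt m) (pt (approx b l)) < inv k + inv l])).
    apply: bigcupT_measurable => m; apply: measurableI; first exact: measurable_approx.
    exact: (measurable_approx_fun (fun r => r < inv k + inv l) (fun i => dist (pt m) (pt i))).
  apply/seteqP; split=> b /=; first by exists (approx b k).
  by case=> m _ [<-].
by apply/seteqP; split=> b /= h k => [_ l _|l]; [exact: h|exact: (h k I l I)].
Qed.

(** Decoding takes the limit of the approximations. Its measurability is tested on
    balls: the distance from a fixed point to the decoded point is a pointwise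
    limit of measurable real functions. *)
Lemma bitstream_retract_borel : bitstream_retract (borel E).
Proof.
have [g gP] := choice approx_point_cvg.
pose B j : set (borel E) :=
  if (unpickle j : option (nat * nat)) is Some (m, l) then dball (pt m) (inv l) else set0.
have gdist b (e : R) : 0 < e -> exists N, forall l, (N <= l)%N ->
    dist (g b) (approx_point b l) < e.
  move=> e0; have nb : nbhs (g b) (dball (g b) e).
    by apply/(dist_nbhs hdist); exists e.
  by have [N _ NP] := gP b _ nb; exists N => l /NP.
exists B, g; split.
- by move=> j; rewrite /B; case: (unpickle j) => [[m l]|] //; exact: measurable_dball.
- have mgd z : measurable_fun setT (fun b : bitstream => dist z (g b)).
    apply: (@measurable_fun_cvg _ _ _ _ (fun l (b : bitstream) => dist z (approx_point b l))).
      move=> l.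
      rewrite (_ : (fun b => _) = fun b : bitstream => if `[<coherent b>]
        then dist z (pt (approx b l)) else dist z (pt 0)); last first.
        by apply/funext => b; rewrite /approx_point; case: asboolP.
      apply: measurable_fun_ifT => //.
        apply: (measurable_fun_bool true); rewrite setTI.
        rewrite (_ : _ @^-1` _ = [set b : bitstream | coherent b]).
          exact: measurable_coherent.
        by apply/seteqP; split=> b /= /asboolP.
      move=> _ Y mY; rewrite setTI.
      exact: (measurable_approx_fun Y (fun i => dist z (pt i))).
    move=> b _; apply/cvgrPdist_lt => e /(gdist b)[N NP].
    exists N => // l /= /NP gl.
    have := dtri z (g b) (approx_point b l); have := dtri z (approx_point b l) (g b).
    by rewrite (dsym (approx_point b l)) ltr_norml; lra.
  apply: (measurability (@open E : set (set (borel E)))) => // _ [U oU <-].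
  rewrite setTI (open_dball oU) preimage_bigcup; apply: bigcupT_measurable => m.
  rewrite preimage_bigcup; apply: bigcupT_measurable => l.
  case: ifP => _; last by rewrite preimage_set0.
  have := mgd (pt m) measurableT `]-oo, inv l[%classic (measurable_itv _).
  rewrite setTI; congr measurable; apply/seteqP; split=> b /=; rewrite in_itv //=.
- move=> x; set b := (fun i => _).
  have bE m l : b (pickle (m, l)) = (dist (pt m) x < inv l).
    by rewrite /b /B pickleK; apply/asboolP/idP.
  have bx l : dist (pt (approx b l)) x < inv l.
    have [m xm] := near_point x l.
    have := @first_indexP (fun m => b (pickle (m, l))); rewrite -/(approx b l) bE.
    by apply; exists m; rewrite bE dsym.
  have cb : coherent b.
    move=> k l; have := bx k; have := bx l; have := dtri (pt (approx b k)) x (pt (approx b l)).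
    by rewrite (dsym x); move: (inv k) (inv l) => a c; lra.
  apply: (dist_eq0 hdist); apply/eqP; rewrite eq_le dist_ge0 andbT.
  apply/ler_addgt0Pl => e e0; rewrite addr0.
  have e2 : 0 < e / 2 by rewrite divr_gt0.
  have [N NP] := gdist b _ e2; have [M MP] := small_inverse e2.
  have := NP _ (leq_maxl N M); have := MP _ (leq_maxr N M); have := bx (maxn N M).
  rewrite /approx_point asboolT//.
  by have := dtri (g b) (pt (approx b (maxn N M))) x; move: (inv (maxn N M)) => a; lra.
Qed.

End polish.

Lemma polish_bitstream_retract (R : realType) (E : ptopologicalType) :
  polish_space R E -> bitstream_retract (borel E).
Proof.
move=> [[S cS dS] [dist hdist]].
have [pt ptS] := pcard_surjP cS.
apply: (bitstream_retract_borel hdist (pt := pt)) => U U0 oU.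
have [x [Ux Sx]] := dS U U0 oU; exists x; split=> //.
by have [m _ mx] := ptS x Sx; exists m.
Qed.

(** * Laws of the pasts of a process *)

Lemma exists_meet_pushforward (R : realType) d (T : measurableType d)
    d' (S : measurableType d') (mu nu : {finite_measure set T -> \bar R}) (Z : T -> S) :
  measurable_fun setT Z ->
  exists m : {finite_measure set S -> \bar R},
    (forall A, measurable A -> m A <= Order.min (mu (Z @^-1` A)) (nu (Z @^-1` A)))%E /\
    forall m' : {measure set S -> \bar R},
      (forall A, measurable A -> m' A <= Order.min (mu (Z @^-1` A)) (nu (Z @^-1` A)))%E ->
      forall A, measurable A -> (m' A <= m A)%E.
Proof.
move=> mZ; have [a aE] := finite_pushforward mu mZ.
have [b bE] := finite_pushforward nu mZ.
have [m [mab m_max]] := exists_meet a b.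
exists m; split=> [A mA|m' m'ab A mA].
  by have := mab A mA; rewrite [X in (_ <= Order.min X _)%E]aE [X in (_ <= Order.min _ X)%E]bE.
apply: m_max => // B mB.
by rewrite [X in (_ <= Order.min X _)%E]aE [X in (_ <= Order.min _ X)%E]bE; exact: m'ab.
Qed.

Section unit_mass.
Context {R : realType} {d : measure_display} {T : measurableType d}.
Variable p : {measure set T -> \bar R}.
Hypothesis p1 : p setT = 1%E.

Definition unit_mass_measure of p setT = 1%E : set T -> \bar R := p.

HB.instance Definition _ := Measure.on (unit_mass_measure p1).
HB.instance Definition _ :=
  Measure_isProbability.Build _ _ _ (unit_mass_measure p1) p1.

Lemma exists_probability : exists P : probability T R, forall A, P A = p A.
Proof. by exists (unit_mass_measure p1). Qed.

End unit_mass.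

Section paths.
Context {R : realType} {E : ptopologicalType} {n : nat}.
Local Notation path := (n.+1.-tuple (borel E)).

(** Defined for every natural number k, so as to give a projective sequence
    indexed by nat; [inord] returns its argument as long as k <= n. *)
Definition past (k : nat) (w : path) : k.+1.-tuple (borel E) :=
  [tuple tnth w (inord i) | i < k.+1].

Definition forget_last (k : nat) (s : k.+2.-tuple (borel E)) : k.+1.-tuple (borel E) :=
  [tuple tnth s (widen_ord (leqnSn k.+1) i) | i < k.+1].

Lemma measurable_past k : measurable_fun setT (past k).
Proof.
apply/measurable_fun_tnthP => i.
rewrite (_ : _ \o _ = @tnth _ _ ^~ (inord i)); first exact: measurable_tnth.
by apply/funext => w; rewrite /= tnth_mktuple.
Qed.

Lemma measurable_forget_last k : measurable_fun setT (@forget_last k).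
Proof.
apply/measurable_fun_tnthP => i.
rewrite (_ : _ \o _ = @tnth _ _ ^~ (widen_ord (leqnSn k.+1) i)); first exact: measurable_tnth.
by apply/funext => w; rewrite /= tnth_mktuple.
Qed.

Lemma forget_last_past k w : past k w = forget_last (past k.+1 w).
Proof. by apply: eq_from_tnth => i; rewrite !tnth_mktuple. Qed.

Lemma measurable_past_graph k : bitstream_retract (borel E) ->
  measurable [set q : k.+1.-tuple (borel E) * path | past k q.2 = q.1].
Proof.
move=> /measurable_diagonal mdiag.
rewrite (_ : [set q | _] = \bigcap_(i in [set: 'I_k.+1])
  [set q : k.+1.-tuple (borel E) * path | tnth q.2 (inord i) = tnth q.1 i]).
  apply: fin_bigcap_measurable => // i _; rewrite -[X in measurable X]setTI.
  have mf : measurable_fun setT (fun q : k.+1.-tuple (borel E) * path =>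
      (tnth q.2 (inord i), tnth q.1 i)).
    by apply: measurable_fun_pair; apply: measurableT_comp (measurable_tnth _) _.
  exact: (mf measurableT _ mdiag).
apply/seteqP; split=> -[s w] /=.
  by move=> <- i _; rewrite /= tnth_mktuple.
by move=> h; apply: eq_from_tnth => i; rewrite /past tnth_mktuple h.
Qed.

Section process_paths.
Context {d : measure_display} {T : measurableType d} {P : probability T R}.
Variable X : 'I_n.+1 -> {RV P >-> borel E}.

Lemma past_initial_segment (k : 'I_n.+1) w :
  past k (initial_segment X ord_max w) = initial_segment X k w.
Proof.
apply: eq_from_tnth => i; rewrite !tnth_mktuple; congr (X _ w).
by apply: val_inj; rewrite /= inordK// (leq_trans (ltn_ord i)).
Qed.

Lemma law_past (k : 'I_n.+1) A : law X ord_max (past k @^-1` A) = law X k A.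
Proof.
rewrite /law /distribution /pushforward; congr (P _).
by apply/seteqP; split=> w; rewrite /= past_initial_segment.
Qed.

(** Both initial laws are the Dirac mass at x0, so their meet has mass 1. *)
Lemma law_begun_at x0 (A : set (1.-tuple (borel E))) : begun_at X x0 -> measurable A ->
  law X ord_max (past 0 @^-1` A) = (\1_A [tuple x0])%:E.
Proof.
move=> [N [mN N0 XN]] mA.
have X0 w : ~ N w -> initial_segment X ord0 w = [tuple x0].
  move=> Nw; apply: eq_from_tnth => i; rewrite !tnth_mktuple (ord1 i).
  have -> : widen_ord (ltn_ord (ord0 : 'I_n.+1)) ord0 = ord0 by exact: val_inj.
  by apply: contrapT => /XN.
rewrite (law_past (k := ord0)) /law /distribution /pushforward indicE.
have mX : measurable (initial_segment X ord0 @^-1` A).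
  by rewrite -[X in measurable X]setTI; exact: measurable_initial_segment.
have [xA|xA] := boolP ([tuple x0] \in A).
  transitivity (P setT); last by rewrite probability_setT.
  apply: (eq_measure_off_null mN) => // w /X0 /= ->.
  by split=> // _; exact: set_mem.
transitivity (P set0); last by rewrite measure0.
apply: (eq_measure_off_null mN) => // w /X0 /= ->.
by split=> // /mem_set; rewrite (negbTE xA).
Qed.

End process_paths.
End paths.

Theorem theorem21 (R : realType) (E : ptopologicalType) (n : nat)
    (hE : polish_space R E) (hn : (0 < n)%N) (x0 : E)
    (dp : measure_display) (Tp : measurableType dp) (Pp : probability Tp R)
    (Xp : 'I_n.+1 -> {RV Pp >-> borel E})
    (dm : measure_display) (Tm : measurableType dm) (Pm : probability Tm R)
    (Xm : 'I_n.+1 -> {RV Pm >-> borel E})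
    (hp : begun_at Xp x0) (hm : begun_at Xm x0) :
  exists (d : measure_display) (T : measurableType d) (P : probability T R)
    (Yp Ym : 'I_n.+1 -> {RV P >-> borel E}),
    [/\ same_law Yp Xp, same_law Ym Xm & mexit Yp Ym].
Proof.
have rE := polish_bitstream_retract hE.
pose path : measurableType _ := n.+1.-tuple (borel E).
pose mu : {finite_measure set path -> \bar R} := law Xp ord_max.
pose nu : {finite_measure set path -> \bar R} := law Xm ord_max.
pose m k := sval (cid (exists_meet_pushforward mu nu (@measurable_past E n k))).
have mP k := svalP (cid (exists_meet_pushforward mu nu (@measurable_past E n k))).
have m_mu k A : measurable A -> (m k A <= mu (past k @^-1` A))%E.
  by move=> mA; have := (mP k).1 A mA; rewrite le_min => /andP[].
have m_nu k A : measurable A -> (m k A <= nu (past k @^-1` A))%E.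
  by move=> mA; have := (mP k).1 A mA; rewrite le_min => /andP[].
have m_max k (m' : {finite_measure set (k.+1.-tuple (borel E)) -> \bar R}) :
    (forall A, measurable A -> (m' A <= mu (past k @^-1` A))%E) ->
    (forall A, measurable A -> (m' A <= nu (past k @^-1` A))%E) ->
    forall A, measurable A -> (m' A <= m k A)%E.
  move=> h1 h2 A mA; apply: (mP k).2 => // B mB.
  by rewrite le_min h1//= h2.
have mu_nu0 A : measurable A -> mu (past 0 @^-1` A) = nu (past 0 @^-1` A).
  by move=> mA; rewrite [LHS](law_begun_at hp mA) [RHS](law_begun_at hm mA).
have [p [p_fst p_snd p_agree]] := @nested_agreement_coupling R _ _ path
  (fun k => k.+1.-tuple (borel E)) (bitstream_retract_tuple n.+1 rE) mu nu
  (@past E n) (@measurable_past E n) (fun k => @measurable_past_graph E n k rE)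
  (@forget_last E) (@measurable_forget_last E) (@forget_last_past E n)
  m m_mu m_nu m_max mu_nu0 n.
have p1 : p setT = 1%E.
  rewrite -(preimage_setT fst) p_fst//.
  exact: probability_setT.
have [P PE] := exists_probability p1.
have mfst (i : 'I_n.+1) : measurable_fun setT (fun w : path * path => tnth w.1 i : borel E).
  by apply: measurableT_comp (measurable_tnth i) _.
have msnd (i : 'I_n.+1) : measurable_fun setT (fun w : path * path => tnth w.2 i : borel E).
  by apply: measurableT_comp (measurable_tnth i) _.
(* The coupled processes are the coordinates on the space of pairs of paths. *)
pose Yp i : {RV P >-> borel E} := HB.pack (fun w : path * path => tnth w.1 i : borel E)
  (isMeasurableFun.Build _ _ _ _ _ (mfst i)).
pose Ym i : {RV P >-> borel E} := HB.pack (fun w : path * path => tnth w.2 i : borel E)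
  (isMeasurableFun.Build _ _ _ _ _ (msnd i)).
exists _, (path * path)%type, P, Yp, Ym.
have initYp w : initial_segment Yp ord_max w = w.1.
  apply: eq_from_tnth => i; rewrite tnth_mktuple /=; congr (tnth _ _); exact: val_inj.
have initYm w : initial_segment Ym ord_max w = w.2.
  apply: eq_from_tnth => i; rewrite tnth_mktuple /=; congr (tnth _ _); exact: val_inj.
have lawYp A : measurable A -> law Yp ord_max A = mu A.
  move=> mA; rewrite -p_fst// -PE /law /distribution /pushforward; congr (P _).
  by apply/seteqP; split=> w; rewrite /= initYp.
have lawYm A : measurable A -> law Ym ord_max A = nu A.
  move=> mA; rewrite -p_snd// -PE /law /distribution /pushforward; congr (P _).
  by apply/seteqP; split=> w; rewrite /= initYm.
split; [exact: lawYp|exact: lawYm|move=> k].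
have mpast A : measurable A -> measurable (past k @^-1` A : set path).
  by move=> mA; rewrite -[X in measurable X]setTI; exact: measurable_past.
have lawYpk A : measurable A -> law Yp k A = mu (past k @^-1` A).
  by move=> mA; rewrite -law_past lawYp//; exact: mpast.
have lawYmk A : measurable A -> law Ym k A = nu (past k @^-1` A).
  by move=> mA; rewrite -law_past lawYm//; exact: mpast.
exists (m k); last first.
  move=> A mA; have kn : (k <= n)%N by rewrite -ltnS ltn_ord.
  apply: eq_trans (p_agree k A kn mA); rewrite PE; congr (p _); apply/seteqP; split=> w.
    move=> [Aw agree]; split.
      by move: Aw; rewrite /= -past_initial_segment initYp.
    apply: eq_from_tnth => i; rewrite !tnth_mktuple.
    apply: (agree (inord i)); rewrite inordK; first by rewrite -ltnS ltn_ord.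
    exact: (leq_trans (ltn_ord i)).
  move=> [Aw agree]; split; first by rewrite /= -past_initial_segment initYp.
  move=> i ik; have := congr1 (fun s => tnth s (inord i)) agree.
  by rewrite !tnth_mktuple inordK// inord_val.
split=> [A mA|m' m'le A mA].
  by rewrite [X in Order.min X _]lawYpk// [X in Order.min _ X]lawYmk//; exact: (mP k).1.
apply: (mP k).2 => // B mB; have := m'le B mB.
by rewrite [X in Order.min X _]lawYpk// [X in Order.min _ X]lawYmk.
Qed.
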